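(* Let $G$ be a connected graph and let $e_i$ be an edge of $G$ with end points $p_i,q_i$. For any $s,t\in V(G)$, $$t(G)\,t\big((G-e_i)_{st}\big)=t(G_{st})\,t(G-e_i)+\frac14\big[t(G_{p_is})-t(G_{q_is})-t(G_{p_it})+t(G_{q_it})\big]^2.$$
   Context: Graphs are finite and may have multiple edges and loops; $t(H)$ is the number of spanning trees of $H$ ($0$ if $H$ is disconnected, $1$ if $H$ has one vertex). $G-e_i$ is $G$ with the edge $e_i$ deleted. For vertices $x,y$ of $H$, $H_{xy}$ is obtained by identifying $x$ and $y$, with the convention $t(H_{xx}):=0$. *)

(* Defs.v *)
From mathcomp Require Import all_boot all_order all_algebra.
Set Implicit Arguments. Unset Strict Implicit. Unset Printing Implicit Defensive.

Record mgraph (V E : finType) := MGraph {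
  vset : {set V};
  eset : {set E};
  ends : E -> V * V }.

Section Graphs.
Variables (V E : finType).
Implicit Types (G : mgraph V E) (F : {set E}).

Definition adj (Vs : {set V}) (en : E -> V * V) F : rel V :=
  fun x y => [&& x \in Vs, y \in Vs &
    [exists e in F, (en e == (x, y)) || (en e == (y, x))]].

Definition connected_on (Vs : {set V}) (en : E -> V * V) F : bool :=
  [forall x in Vs, forall y in Vs, connect (adj Vs en F) x y].

Definition connectedG G : bool := connected_on (vset G) (ends G) (eset G).

(* F is acyclic: every edge of F is a bridge of (V, F); in particular no loops *)
Definition acyclic_on (Vs : {set V}) (en : E -> V * V) F : bool :=
  [forall e in F, ~~ connect (adj Vs en (F :\ e)) (en e).1 (en e).2].

Definition spanning_tree G F : bool :=
  [&& F \subset eset G, connected_on (vset G) (ends G) F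
    & acyclic_on (vset G) (ends G) F].

Definition ntrees G : nat := #|[set F : {set E} | spanning_tree G F]|.

Definition delete_edge G (e : E) : mgraph V E :=
  MGraph (vset G) (eset G :\ e) (ends G).

Definition merge (x y v : V) : V := if v == y then x else v.

Definition identify G (x y : V) : mgraph V E :=
  MGraph (vset G :\ y) (eset G)
    (fun e => (merge x y (ends G e).1, merge x y (ends G e).2)).

(* t(G_xy), with the convention t(G_xx) = 0 *)
Definition tid G (x y : V) : nat := if x == y then 0 else ntrees (identify G x y).

Definition full_graph (en : E -> V * V) : mgraph V E := MGraph [set: V] [set: E] en.

End Graphs.

(* Main.v *)
(** Fix a root [r] and let [K] be the Laplacian of [G] plus the rank-one term
    supported at [r]; by the matrix-tree theorem, t(G) = det K, proved here by
    deletion-contraction.  Contracting [x] and [y] is a unimodular change of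
    basis followed by a projection, which gives
    t(G_xy) = det (K + b b^T) - det K with b = e_x - e_y.  All the tree counts
    in the theorem are thus determinants of perturbations of [K] of rank at most
    two, and they become polynomials in det K and the entries of K^-1. *)
Require Import Defs.
From mathcomp Require Import all_boot all_order all_algebra.
From mathcomp Require Import ring.
Import GRing.Theory.
Set Implicit Arguments. Unset Strict Implicit. Unset Printing Implicit Defensive.
Local Open Scope ring_scope.

(** * Connectivity of edge sets and exchange of edges *)

Lemma connect_map (T T' : finType) (e : rel T) (e' : rel T') (h : T -> T') x y :
  (forall u v, e u v -> connect e' (h u) (h v)) ->
  connect e x y -> connect e' (h x) (h y).
Proof.
move=> eh /connectP[p]; elim: p x => [|z p IHp] x /=; first by move=> _ ->.
by case/andP=> /eh xz /IHp zy /zy; apply: connect_trans.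
Qed.

Section Connectivity.
Variables (V E : finType).
Implicit Types (Vs : {set V}) (en : E -> V * V) (F S : {set E}).

Definition ends_in Vs en F :=
  forall e, e \in F -> ((en e).1 \in Vs) && ((en e).2 \in Vs).

Lemma adj_edge Vs en F e : ends_in Vs en F -> e \in F ->
  adj Vs en F (en e).1 (en e).2.
Proof.
move=> wf Fe; have /andP[e1 e2] := wf e Fe; rewrite /adj e1 e2.
by apply/existsP; exists e; rewrite Fe -surjective_pairing eqxx.
Qed.

Lemma adj_sym Vs en F : symmetric (adj Vs en F).
Proof.
by move=> x y; rewrite /adj andbCA; do 2!congr andb;
  apply: eq_existsb => e; rewrite orbC.
Qed.

Lemma adj_connect_sym Vs en F : connect_sym (adj Vs en F).
Proof. exact: sym_connect_sym (@adj_sym Vs en F). Qed.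

Lemma adj_mono Vs en F S : F \subset S -> subrel (adj Vs en F) (adj Vs en S).
Proof.
move=> /subsetP FS x y /and3P[xV yV /existsP[e /andP[/FS Fe exy]]].
by rewrite /adj xV yV; apply/existsP; exists e; rewrite Fe.
Qed.

Lemma connect_mono Vs en F S x y : F \subset S ->
  connect (adj Vs en F) x y -> connect (adj Vs en S) x y.
Proof. by move=> FS; apply: connect_sub => u v /(adj_mono FS)/connect1. Qed.

Lemma connected_onP Vs en F :
  reflect {in Vs &, forall x y, connect (adj Vs en F) x y}
          (connected_on Vs en F).
Proof.
apply: (iffP forall_inP) => [c x y xV yV|c x xV].
  by have /forall_inP := c x xV; apply.
by apply/forall_inP => y; apply: c.
Qed.

(** Each use of [e] in a walk is replaced by the connection of its ends in [S]. Since [e] may or may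
    not lie in [S], this covers both dropping an edge and swapping it for another. *)
Lemma connect_reroute Vs en F S e x y :
  F :\ e \subset S -> connect (adj Vs en S) (en e).1 (en e).2 ->
  connect (adj Vs en F) x y -> connect (adj Vs en S) x y.
Proof.
move=> FS ce; apply: connect_sub => u v /and3P[uV vV /existsP[f /andP[Ff fuv]]].
have [fe|fe] := eqVneq f e; last first.
  apply/connect1; rewrite /adj uV vV; apply/existsP; exists f.
  by rewrite fuv (subsetP FS) // !inE fe.
rewrite fe in fuv; case/orP: fuv => /eqP exy; rewrite exy // in ce.
by rewrite adj_connect_sym.
Qed.

Lemma connected_reroute Vs en F S e :
  F :\ e \subset S -> connect (adj Vs en S) (en e).1 (en e).2 ->
  connected_on Vs en F -> connected_on Vs en S.
Proof.
move=> FS ce /connected_onP c; apply/connected_onP => x y xV yV.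
exact: connect_reroute FS ce (c x y xV yV).
Qed.

(** By rerouting, an edge of a connected set is a bridge exactly when its removal destroys
    connectedness. Trees are thus the minimal connected sets, so later arguments about them need
    only track connectedness. *)
Lemma tree_minimalP Vs en F : ends_in Vs en F ->
  reflect (connected_on Vs en F /\ forall e, e \in F -> ~~ connected_on Vs en (F :\ e))
          (connected_on Vs en F && acyclic_on Vs en F).
Proof.
move=> wf; apply: (iffP andP) => -[c min]; split=> //.
  move=> e Fe; apply: contra (forall_inP min e Fe) => /connected_onP; apply.
    by have /andP[] := wf e Fe.
  by have /andP[] := wf e Fe.
apply/forall_inP => e /min; apply: contra => ce.
exact: connected_reroute ce c.
Qed.

(* [f] is the first edge of a simple path from [x] to [y]: the rest of the path
   avoids [x], hence [f], so [e] can replace [f]. *)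
Lemma connected_exchange Vs en S e : ends_in Vs en S ->
  (en e).1 \in Vs -> (en e).2 \in Vs -> (en e).1 != (en e).2 ->
  connected_on Vs en S ->
  exists2 f, f \in S & connected_on Vs en (e |: S :\ f).
Proof.
set x := (en e).1; set y := (en e).2 => wf xV yV xy c.
have /connected_onP/(_ x y xV yV)/connectP[p0 xp0 yl] := c.
case: (shortenP xp0) yl => p xp up _ yl {p0 xp0}.
case: p xp up yl => [|z p] /=; first by move=> _ _ yx; rewrite yx eqxx in xy.
case/andP=> /and3P[_ zV /existsP[f /andP[Sf fxz]]] zp /andP[xzp _] yl.
exists f => //; set S' := e |: S :\ f.
have exy : connect (adj Vs en S') x y.
  apply: connect1; rewrite /adj xV yV; apply/existsP; exists e.
  by rewrite setU11 -surjective_pairing eqxx.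
have yz : connect (adj Vs en S') y z.
  rewrite adj_connect_sym; apply/connectP; exists p => // {yl}.
  have: forall u, path (adj Vs en S) u p -> x \notin u :: p ->
      path (adj Vs en S') u p; last by apply.
  elim: p {zp xzp} => //= w p IHp u.
  case/andP=> /and3P[uV wV /existsP[g /andP[Sg guw]]] wp.
  rewrite inE negb_or => /andP[xu xwp]; rewrite IHp // andbT.
  rewrite /adj uV wV; apply/existsP; exists g; rewrite guw !inE Sg !andbT.
  case: (eqVneq g f) => [gf|]; last by rewrite orbT.
  move: xwp; rewrite inE negb_or => /andP[xw _].
  rewrite gf in guw.
  by case/orP: fxz guw => /eqP-> /orP[]/eqP[eu ew];
    rewrite ?eu ?ew eqxx in xu xw.
have xz := connect_trans exy yz.
apply: (@connected_reroute _ _ S _ f) => //; first exact: subsetUr.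
by case/orP: fxz => /eqP->; rewrite // adj_connect_sym.
Qed.

End Connectivity.

(** * Spanning trees under contraction of an edge *)

Section Contraction.
Variables (V E : finType) (Vs : {set V}) (en : E -> V * V) (x y : V) (e0 : E).
Hypotheses (yV : y \in Vs) (xV : x \in Vs) (xy : x != y) (e0xy : en e0 = (x, y)).

Let Vm := Vs :\ y.
Let enm e := (Defs.merge x y (en e).1, Defs.merge x y (en e).2).

Lemma merge_in v : v \in Vs -> Defs.merge x y v \in Vm.
Proof.
by move=> vV; rewrite /Defs.merge !inE; case: (eqVneq v y) => [|->]; rewrite ?xy.
Qed.

Lemma merge_id v : v \in Vm -> Defs.merge x y v = v.
Proof. by rewrite !inE /Defs.merge => /andP[/negPf->]. Qed.

Lemma ends_in_contract S : ends_in Vs en S -> ends_in Vm enm S.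
Proof. by move=> wf e /wf/andP[? ?]; rewrite /= !merge_in. Qed.

(** Merging maps walks to walks and collapses [e0] to a point. Conversely [e0] joins every vertex to
    its merged image, so each contracted edge lifts to a walk. *)
Lemma connected_contract S : ends_in Vs en S ->
  connected_on Vs en (e0 |: S) = connected_on Vm enm S.
Proof.
move=> wf; have me0 : connect (adj Vs en (e0 |: S)) x y.
  apply/connect1; rewrite /adj xV yV; apply/existsP; exists e0.
  by rewrite setU11 e0xy eqxx.
apply/idP/idP => /connected_onP c; apply/connected_onP => u v uV vV.
  rewrite -(merge_id uV) -(merge_id vV).
  have /setD1P[_ uVs] := uV; have /setD1P[_ vVs] := vV.
  have := c u v uVs vVs.
  apply: connect_map => {uV vV uVs vVs}u {}v /and3P[uV vV /existsP[f]].
  rewrite !inE => /andP[/orP[/eqP->|Sf]].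
    by rewrite e0xy => /orP[]/eqP[<- <-]; rewrite /Defs.merge eqxx (negPf xy).
  move=> fuv; apply/connect1; rewrite /adj !merge_in //.
  by apply/existsP; exists f; rewrite Sf; case/orP: fuv => /eqP fuv;
    rewrite /enm fuv eqxx ?orbT.
have mc w : w \in Vs -> connect (adj Vs en (e0 |: S)) w (Defs.merge x y w).
  rewrite /Defs.merge; case: (eqVneq w y) => [->|] _ //.
  by rewrite adj_connect_sym.
apply: connect_trans (mc u uV) _; rewrite adj_connect_sym.
apply: connect_trans (mc v vV) _; rewrite adj_connect_sym.
have := c _ _ (merge_in uV) (merge_in vV); apply: connect_sub => {uV vV} {}u {}v.
case/and3P => _ _ /existsP[f /andP[Sf fuv]].
have /andP[f1 f2] := wf f Sf.
have fS : connect (adj Vs en (e0 |: S)) (en f).1 (en f).2.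
  exact: connect_mono (subsetUr _ _) (connect1 (adj_edge wf Sf)).
have fS' : connect (adj Vs en (e0 |: S)) (enm f).1 (enm f).2.
  apply: connect_trans (connect_trans fS (mc _ f2)).
  by rewrite adj_connect_sym mc.
by case/orP: fuv fS' => /eqP-> //=; rewrite adj_connect_sym.
Qed.

(** Minimality at the edges of [S] transfers by [connected_contract]. For minimality at [e0]: if [S]
    alone were connected, an exchange would trade some [g] of [S] for [e0], and [S :\ g] would
    already be connected after contraction. *)
Lemma tree_contract (S : {set E}) : e0 \notin S -> ends_in Vs en S ->
  connected_on Vs en (e0 |: S) && acyclic_on Vs en (e0 |: S)
  = connected_on Vm enm S && acyclic_on Vm enm S.
Proof.
move=> e0S wf.
have wf0 : ends_in Vs en (e0 |: S).
  by move=> e /setU1P[->|/wf //]; rewrite e0xy xV yV.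
have wfD f : ends_in Vs en (S :\ f) by move=> e /setD1P[_ /wf].
have DU f : f \in S -> (e0 |: S) :\ f = e0 |: (S :\ f).
  move=> Sf; apply/setP => e; rewrite !inE.
  by case: (eqVneq e e0) => // ->; rewrite eq_sym (memPn e0S f Sf).
apply/(tree_minimalP wf0)/(tree_minimalP (ends_in_contract wf)) => -[c min].
  split=> [|f Sf]; first by rewrite -connected_contract.
  by rewrite -connected_contract // -DU // min // setU1r.
split=> [|f /setU1P[->|Sf]]; first by rewrite connected_contract.
  rewrite setU1K //; apply/negP => cS.
  have [g Sg] : exists2 g, g \in S & connected_on Vs en (e0 |: S :\ g).
    by apply: connected_exchange; rewrite ?e0xy.
  by rewrite connected_contract // (negPf (min g Sg)).
by rewrite DU // connected_contract // min.
Qed.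

End Contraction.

(** * Counting spanning trees by deletion and contraction *)

Section Trees.
Variables (V E : finType).
Implicit Types G : mgraph V E.

Definition wf_graph G := ends_in (vset G) (ends G) (eset G).

Lemma ntrees_gt0 G : wf_graph G -> connectedG G -> (0 < ntrees G)%N.
Proof.
move=> wf cG.
have [F minF FG] := minset_exists (P := connected_on (vset G) (ends G)) cG.
apply/card_gt0P; exists F; rewrite inE /spanning_tree FG /=.
have [c min] := minsetP minF.
apply/tree_minimalP; first by move=> e /(subsetP FG)/wf.
split=> // e Fe; apply/negP => /min/(_ (subD1set _ _))/setP/(_ e).
by rewrite !inE eqxx Fe.
Qed.

Lemma ntrees_loop G e : (ends G e).1 = (ends G e).2 ->
  ntrees G = ntrees (delete_edge G e).
Proof.
move=> loop; apply: eq_card => F; rewrite !inE /spanning_tree /= subsetD1.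
case: (boolP (e \in F)) => [Fe|_]; last by rewrite andbT.
rewrite andbF /=; apply/and3P => -[_ _ /forall_inP/(_ e Fe)].
by rewrite loop connect0.
Qed.

(** Trees avoiding [e] are those of the deletion; trees containing [e] are the sets [e |: S] with
    [S] a tree of the contraction. Identification is applied after deleting [e], so that [e] does
    not survive as a loop. *)
Lemma ntrees_contract G e x y : wf_graph G -> e \in eset G ->
  ends G e = (x, y) -> x != y ->
  ntrees G = (ntrees (delete_edge G e) + ntrees (identify (delete_edge G e) x y))%N.
Proof.
move=> wf Ge exy xy.
have /andP[] := wf e Ge; rewrite exy /= => xV yV.
rewrite /ntrees -(cardsID [set F : {set E} | e \in F]) addnC; congr addn.
  apply: eq_card => F; rewrite !inE /spanning_tree /= subsetD1.
  by case: (e \in F); rewrite ?andbF ?andbT.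
rewrite -[RHS](card_in_imset (f := fun F => e |: F)); last first.
  move=> F F'; rewrite !inE /spanning_tree /= !subsetD1.
  move=> /andP[/andP[_ eF] _] /andP[/andP[_ eF'] _] eq.
  by rewrite -(setU1K eF) eq setU1K.
apply: eq_card => F; apply/idP/imsetP.
  rewrite !inE => /andP[/and3P[FG c a] Fe]; exists (F :\ e); last by rewrite setD1K.
  rewrite inE /spanning_tree /= setSD //=.
  rewrite -(@tree_contract _ _ _ _ _ _ e) // ?setD1K ?c ?a // ?setD11 //.
  by move=> f /setD1P[_ /(subsetP FG)/wf].
case=> S; rewrite !inE /spanning_tree /= subsetD1 => /andP[/andP[SG eS]] t ->.
rewrite setU11 andbT subUset sub1set Ge SG /=.
rewrite (@tree_contract _ _ _ _ x y) //.
by move=> f /(subsetP SG)/wf.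
Qed.

End Trees.

(** * Determinant identities *)

Section Determinants.
Variable R : comNzRingType.

(** One block matrix is written in two ways as a product of block-triangular factors. The identity
    turns a low-rank update into a small determinant. *)
Lemma det_sylvester m n (A : 'M[R]_(m, n)) (B : 'M[R]_(n, m)) :
  \det (1%:M + A *m B) = \det (1%:M + B *m A).
Proof.
have eqAB : block_mx 1%:M 0 (- B) 1%:M *m block_mx 1%:M A 0 (1%:M + B *m A)
  = block_mx 1%:M A 0 1%:M *m block_mx (1%:M + A *m B) 0 (- B) 1%:M.
  rewrite !mulmx_block !(mul1mx, mulmx1, mul0mx, mulmx0, addr0, add0r).
  by rewrite mulNmx mulmxN addrK [- _ + _]addrC addrK.
move/(congr1 determinant): eqAB; rewrite !det_mulmx !det_ublock !det_lblock.
by rewrite !det1 !(mul1r, mulr1).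
Qed.

Lemma det_add_delta n (M : 'M[R]_n) i :
  \det (M + delta_mx i i) = \det M + cofactor M i i.
Proof.
rewrite (expand_det_row _ i) (expand_det_row M i).
have cof j : cofactor (M + delta_mx i i) i j = cofactor M i j.
  rewrite /cofactor; congr (_ * \det _); apply/matrixP => k l.
  by rewrite !mxE eq_sym (negPf (neq_lift _ _)) addr0.
under eq_bigr do rewrite cof !mxE eqxx mulrDl.
rewrite big_split /=; congr (_ + _).
rewrite (bigD1 i) //= eqxx mul1r big1 ?addr0 // => j /negPf->.
by rewrite mul0r.
Qed.

Lemma det_delta_row n (M : 'M[R]_n) i :
  (forall j, M i j = (i == j)%:R) -> \det M = cofactor M i i.
Proof.
move=> Mi; rewrite (expand_det_row _ i) (bigD1 i) //= Mi eqxx mul1r.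
by rewrite big1 ?addr0 // => j; rewrite Mi eq_sym => /negPf->; rewrite mul0r.
Qed.

Definition unit_vec n (i : 'I_n) : 'cV[R]_n := delta_mx i 0.

Lemma unit_vec_dot n (i j : 'I_n) :
  (unit_vec i)^T *m unit_vec j = (i == j)%:R%:M.
Proof.
rewrite /unit_vec trmx_delta mul_delta_mx_cond -scaler_nat.
by apply/matrixP => a b; rewrite !ord1 !mxE /= mulr1 mulr1n.
Qed.

Lemma unit_vec_norm n (i : 'I_n) : (unit_vec i)^T *m unit_vec i = 1%:M.
Proof. by rewrite unit_vec_dot eqxx. Qed.

Lemma unit_vec_ortho n (i j : 'I_n) : i != j -> (unit_vec i)^T *m unit_vec j = 0.
Proof. by move/negPf; rewrite unit_vec_dot => ->; rewrite raddf0. Qed.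

Lemma unit_vec_out n (i j : 'I_n) : unit_vec i *m (unit_vec j)^T = delta_mx i j.
Proof. by rewrite /unit_vec trmx_delta mul_delta_mx. Qed.

(* Below, [P] is unimodular and sends [e_x - e_y] to [- e_y]; following it by the
   projection along [e_y] gives [Q]. *)
Lemma det_add_diff n (M : 'M[R]_n) (x y : 'I_n) (b := unit_vec x - unit_vec y)
    (Q := 1%:M + b *m (unit_vec y)^T) : x != y ->
  \det (M + b *m b^T) - \det M = \det (Q *m M *m Q^T + delta_mx y y).
Proof.
move=> xy; have yx : y != x by rewrite eq_sym.
pose P : 'M[R]_n := 1%:M + unit_vec x *m (unit_vec y)^T.
have detP : \det P = 1.
  by rewrite det_sylvester unit_vec_ortho // addr0 det1.
have Pb : P *m b = - unit_vec y.
  rewrite mulmxDl mul1mx -mulmxA /b mulmxBr unit_vec_norm unit_vec_ortho //.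
  by rewrite mulmxBr mulmx0 sub0r mulmx1 addrC addKr.
have PbT : (P *m b)^T = - (unit_vec y)^T by rewrite Pb linearN.
pose N := P *m M *m P^T.
have detN : \det N = \det M by rewrite !det_mulmx det_tr detP mul1r mulr1.
have -> : \det (M + b *m b^T) = \det (N + delta_mx y y).
  have -> : \det (M + b *m b^T) = \det (P *m (M + b *m b^T) *m P^T).
    by rewrite !det_mulmx det_tr detP mul1r mulr1.
  rewrite mulmxDr mulmxDl -!mulmxA -trmx_mul PbT.
  by rewrite !mulmxA Pb mulmxN mulNmx opprK unit_vec_out.
(* The difference is now the cofactor of [N] at [y]. As [Q] is [P] with row [y] zeroed,
   [Q *m M *m Q^T] is [N] with row and column [y] zeroed; a 1 at the diagonal place [y] makes its
   determinant that same cofactor. *)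
rewrite det_add_delta detN [\det M + _]addrC addrK.
have QP i j : Q i j = if i == y then 0 else P i j.
  rewrite /Q /P /b mulmxBl !unit_vec_out !mxE.
  case: (eqVneq i y) => [->|_]; last by rewrite subr0.
  by rewrite [y == x]eq_sym (negPf xy) /= sub0r [j == y]eq_sym subrr.
clearbody Q P.
have QN i j : (Q *m M *m Q^T) i j = if (i == y) || (j == y) then 0 else N i j.
  rewrite !mxE; case: ifP => [ijy|/norP[iy jy]].
    apply: big1 => k _; rewrite !mxE.
    case/orP: ijy => /eqP->; last by rewrite QP eqxx mulr0.
    by rewrite big1 ?mul0r // => l _; rewrite QP eqxx mul0r.
  apply: eq_bigr => k _; rewrite !mxE QP (negPf jy); congr (_ * _).
  by apply: eq_bigr => l _; rewrite QP (negPf iy).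
clearbody N; set M' := Q *m M *m Q^T in QN *; clearbody M'.
rewrite (det_delta_row (i := y)) => [|j].
  rewrite /cofactor; congr (_ * \det _); apply/matrixP => i j.
  rewrite !mxE QN !(eq_sym _ y) !(negPf (neq_lift _ _)) /=.
  by rewrite addr0.
by rewrite !mxE QN eqxx add0r eq_sym.
Qed.

End Determinants.

(** * The matrix-tree theorem *)

Section MatrixTree.
Variables (R : comNzRingType) (V E : finType).
Implicit Types (G : mgraph V E) (u : 'cV[R]_#|V|) (r v x y : V).

Definition vertex_vec v : 'cV[R]_#|V| := unit_vec R (enum_rank v).

Definition edge_vec (xy : V * V) := vertex_vec xy.1 - vertex_vec xy.2.

Definition sqmx u : 'M[R]_#|V| := u *m u^T.

Lemma sqmx_congr (Q : 'M[R]_#|V|) u : Q *m sqmx u *m Q^T = sqmx (Q *m u).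
Proof. by rewrite /sqmx trmx_mul !mulmxA. Qed.

Lemma sqmx_vertex v : sqmx (vertex_vec v) = delta_mx (enum_rank v) (enum_rank v).
Proof. exact: unit_vec_out. Qed.

(* Vertices outside [vset G] get a diagonal [1], so that all the graphs obtained
   by identifications have matrices of the same size. *)
Definition kirchhoff G r : 'M[R]_#|V| :=
  \sum_(v in ~: vset G) sqmx (vertex_vec v) + sqmx (vertex_vec r)
  + \sum_(e in eset G) sqmx (edge_vec (ends G e)).

(** The [Q] of [det_add_diff], read as the linear extension of [merge x y] to vertex vectors. *)
Definition merge_mx x y : 'M[R]_#|V| :=
  1%:M + edge_vec (x, y) *m (vertex_vec y)^T.

Lemma merge_mx_vertex x y v :
  merge_mx x y *m vertex_vec v = vertex_vec (Defs.merge x y v).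
Proof.
rewrite /merge_mx mulmxDl mul1mx -mulmxA /Defs.merge.
case: (eqVneq v y) => [->|vy].
  by rewrite unit_vec_norm mulmx1 /edge_vec addrC subrK.
rewrite unit_vec_ortho ?mulmx0 ?addr0 //.
by rewrite (inj_eq enum_rank_inj) eq_sym.
Qed.

(** The congruence pushes every rank-one term along [merge x y], including the root term. The extra
    square at [y] is the diagonal 1 due to [y] once it has left the vertex set. *)
Lemma kirchhoff_identify G r x y : y \in vset G ->
  merge_mx x y *m kirchhoff G r *m (merge_mx x y)^T + sqmx (vertex_vec y)
  = kirchhoff (identify G x y) (Defs.merge x y r).
Proof.
move=> yV; have Qv := merge_mx_vertex x y.
move: (merge_mx x y) Qv => Q Qv.
rewrite /kirchhoff !(mulmxDr, mulmxDl) !mulmx_sumr !mulmx_suml /=.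
rewrite sqmx_congr Qv addrC !addrA; congr (_ + _ + _).
  rewrite [RHS](big_setD1 y) /=; last by rewrite in_setC in_setD1 eqxx.
  congr (_ + _); apply: congr_big => // [v|v]; rewrite ?inE.
    by case: (eqVneq v y) => [->|]; rewrite ?yV.
  move=> vV; rewrite sqmx_congr Qv /Defs.merge.
  by case: (eqVneq v y) vV => // ->; rewrite yV.
by apply: eq_bigr => e _; rewrite sqmx_congr mulmxBr !Qv.
Qed.

Lemma det_kirchhoff_identify G r x y : y \in vset G -> x != y ->
  \det (kirchhoff (identify G x y) (Defs.merge x y r))
  = \det (kirchhoff G r + sqmx (edge_vec (x, y))) - \det (kirchhoff G r).
Proof.
move=> yV xy; rewrite -kirchhoff_identify // sqmx_vertex.
by rewrite /sqmx /edge_vec det_add_diff // (inj_eq enum_rank_inj).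
Qed.

Lemma kirchhoff_delete G r e : e \in eset G ->
  kirchhoff G r = kirchhoff (delete_edge G e) r + sqmx (edge_vec (ends G e)).
Proof.
by move=> Ge; rewrite /kirchhoff (big_setD1 e) //= addrA addrAC.
Qed.

Lemma ntrees_edgeless G r : eset G = set0 -> r \in vset G ->
  ntrees G = (vset G == [set r]) :> nat.
Proof.
move=> E0 rV; have [Vr|Vr] := eqVneq (vset G) [set r].
  rewrite /ntrees (_ : [set F | _] = [set set0]) ?cards1 //.
  apply/setP => F; rewrite !inE /spanning_tree E0 subset0 andb_idr // => /eqP->.
  rewrite Vr; apply/andP; split; last by apply/forall_inP => e; rewrite inE.
  by apply/connected_onP => x y /set1P-> /set1P->.
apply: eq_card0 => F; rewrite !inE /spanning_tree E0 subset0.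
apply/and3P => -[/eqP-> /connected_onP c _]; case/negP: Vr.
rewrite eqEsubset sub1set rV andbT; apply/subsetP => x xV; rewrite inE eq_sym.
have /connectP[[|z p] /= ] := c r x rV xV; first by move=> _ ->.
by case/andP=> /and3P[_ _ /existsP[e]]; rewrite inE.
Qed.

Lemma det_kirchhoff_edgeless G r : eset G = set0 -> r \in vset G ->
  \det (kirchhoff G r) = (vset G == [set r])%:R.
Proof.
move=> E0 rV; rewrite /kirchhoff E0 big_set0 addr0.
have [Vr|Vr] := eqVneq (vset G) [set r].
  have -> : \sum_(v in ~: vset G) sqmx (vertex_vec v) + sqmx (vertex_vec r) = 1%:M.
    rewrite Vr addrC -setTD -(big_setD1 r (in_setT r)) /= mx1_sum_delta.
    rewrite (reindex enum_rank) /=; last exact: (onW_bij _ (enum_rank_bij V)).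
    by apply: eq_big => v; rewrite ?inE ?sqmx_vertex.
  exact: det1.
case: (pickP [pred w in vset G | w != r]) => [w /andP[/= wV wr]|V0]; last first.
  case/eqP: Vr; apply/setP => v; rewrite inE.
  case: (eqVneq v r) => [->|vr] //.
  by have /= := V0 v; rewrite vr andbT.
(* A vertex [w] of the graph other than the root gives a zero row. *)
rewrite (expand_det_row _ (enum_rank w)) big1 // => j _.
rewrite mxE summxE big1 => [|v vV].
  rewrite add0r sqmx_vertex mxE (inj_eq enum_rank_inj) (negPf wr).
  by rewrite mul0r.
rewrite sqmx_vertex mxE (inj_eq enum_rank_inj).
by case: (eqVneq w v) vV => // <-; rewrite inE wV.
Qed.

(** Induction on the number of edges: a loop contributes a zero vector, and for any other edge the
    increment of the determinant is that of the contraction. The root is generalized because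
    contraction may move it. *)
Lemma matrix_tree G r : wf_graph G -> r \in vset G ->
  (ntrees G)%:R = \det (kirchhoff G r).
Proof.
have [n] := ubnP #|eset G|; elim: n => // n IHn in G r *.
rewrite ltnS => En wf rV.
have [E0|[e Ge]] := set_0Vmem (eset G).
  by rewrite (ntrees_edgeless E0 rV) det_kirchhoff_edgeless.
have En' : (#|eset G :\ e| < n)%N by rewrite (leq_trans _ En) // (cardsD1 e (eset G)) Ge.
have wf' : wf_graph (delete_edge G e) by move=> f /setD1P[_ /wf].
case exy: (ends G e) => [x y]; rewrite (kirchhoff_delete _ Ge) exy.
have [xy|xy] := eqVneq x y.
  rewrite (ntrees_loop (e := e)) ?exy // (IHn _ r) // xy.
  by rewrite /edge_vec subrr /sqmx mul0mx addr0.
have /andP[] := wf e Ge; rewrite exy /= => xV yV.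
rewrite (ntrees_contract wf Ge exy xy) natrD (IHn _ r) //.
rewrite (IHn _ (Defs.merge x y r)) ?merge_in //; last exact: ends_in_contract.
by rewrite det_kirchhoff_identify // addrC subrK.
Qed.

(** The convention for [x = y] fits the formula, since the edge vector is then zero. *)
Lemma tid_det G r x y : wf_graph G ->
  r \in vset G -> x \in vset G -> y \in vset G ->
  (tid G x y)%:R
  = \det (kirchhoff G r + sqmx (edge_vec (x, y))) - \det (kirchhoff G r).
Proof.
move=> wf rV xV yV; rewrite /tid; have [->|xy] := eqVneq x y.
  by rewrite /edge_vec subrr /sqmx mul0mx addr0 subrr.
rewrite (matrix_tree (r := Defs.merge x y r)) ?merge_in //.
  exact: det_kirchhoff_identify.
exact: ends_in_contract.
Qed.

Lemma kirchhoff_sym G r : (kirchhoff G r)^T = kirchhoff G r.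
Proof.
have sq_sym u : (sqmx u)^T = sqmx u by rewrite /sqmx trmx_mul trmxK.
rewrite /kirchhoff !linearD /= sq_sym !linear_sum /=.
by congr (_ + _ + _); apply: eq_bigr => ? _; rewrite sq_sym.
Qed.

End MatrixTree.

(** * Low-rank updates of an invertible matrix *)

Section RankTwo.
Variables (F : fieldType) (n : nat) (K : 'M[F]_n).
Hypothesis Ku : K \in unitmx.

(** A discrete Green function: when [K] is the rooted Laplacian of a connected graph, its value at
    an edge vector taken twice is the effective resistance between the ends. *)
Definition green (u v : 'cV[F]_n) : F := (u^T *m invmx K *m v) 0 0.

Lemma det_add_mul m (U : 'M[F]_(n, m)) (W : 'M[F]_(m, n)) :
  \det (K + U *m W) = \det K * \det (1%:M + W *m invmx K *m U).
Proof.
rewrite -mulmxA det_sylvester -det_mulmx mulmxDr mulmx1 !mulmxA.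
by rewrite mulmxV // mul1mx.
Qed.

Lemma det_add_rank1 u v : \det (K + u *m v^T) = \det K * (1 + green v u).
Proof. by rewrite det_add_mul det_mx11 mxE [X in X + _]mxE. Qed.

Lemma det2 (A : 'M[F]_(1 + 1)) :
  \det A = A 0 0 * A 1 1 - A 0 1 * A 1 0.
Proof.
rewrite (expand_det_row _ 0) !big_ord_recl big_ord0 /cofactor !det_mx11 !mxE /=.
have -> : lift (0 : 'I_(1+1)) 0 = 1 by apply: val_inj.
have -> : lift (1 : 'I_(1+1)) 0 = 0 by apply: val_inj.
by rewrite addr0 expr0 expr1 mul1r mulN1r mulrN.
Qed.

(** Both updates are gathered into one product through a two-dimensional space, which leaves a 2 by
    2 determinant. *)
Lemma det_add_rank2 u v w z :
  \det (K + u *m v^T + w *m z^T)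
  = \det K * ((1 + green v u) * (1 + green z w) - green v w * green z u).
Proof.
rewrite -addrA -mul_row_col det_add_mul mul_col_mx mul_col_row.
rewrite (scalar_mx_block 1 1) add_block_mx !add0r det2.
have -> : (0 : 'I_(1 + 1)) = lshift 1 0 by apply: val_inj.
have -> : (1 : 'I_(1 + 1)) = rshift 1 0 by apply: val_inj.
rewrite block_mxEul block_mxEur block_mxEdl block_mxEdr.
have diag (X : 'M[F]_1) : (1%:M + X) 0 0 = 1 + X 0 0 by rewrite !mxE.
by rewrite !diag.
Qed.

Lemma greenBl u v w : green (u - v) w = green u w - green v w.
Proof. by rewrite /green linearB /= !mulmxBl !mxE. Qed.

Lemma greenBr u v w : green w (u - v) = green w u - green w v.
Proof. by rewrite /green mulmxBr !mxE. Qed.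

Lemma greenNr u w : green w (- u) = - green w u.
Proof. by rewrite -sub0r greenBr /green mulmx0 mxE sub0r. Qed.

Lemma green_sym u v : K^T = K -> green u v = green v u.
Proof.
move=> Ksym; rewrite /green.
have <- : (u^T *m invmx K *m v)^T = v^T *m invmx K *m u.
  by rewrite !trmx_mul trmx_inv Ksym trmxK mulmxA.
by rewrite [RHS]mxE.
Qed.

End RankTwo.

(** * The identity for tree counts *)

Theorem theorem5p3 (V E : finType) (en : E -> V * V) (ei : E) (p q s t : V) :
  connectedG (full_graph en) ->
  en ei = (p, q) ->
  ((ntrees (full_graph en) * tid (delete_edge (full_graph en) ei) s t)%:R : rat)
  = (tid (full_graph en) s t * ntrees (delete_edge (full_graph en) ei))%:R
    + 1 / 4 * ((tid (full_graph en) p s)%:R - (tid (full_graph en) q s)%:R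
               - (tid (full_graph en) p t)%:R + (tid (full_graph en) q t)%:R) ^+ 2.
Proof.
move=> conn epq; set G := full_graph en; set G' := delete_edge G ei.
have wf : wf_graph G by move=> e _; rewrite !inE.
have wf' : wf_graph G' by move=> e _; rewrite !inE.
have vG (x : V) : x \in vset G by rewrite inE.
have vG' (x : V) : x \in vset G' by rewrite inE.
pose K := kirchhoff rat G p.
have nG : (ntrees G)%:R = \det K by exact: matrix_tree.
(* Connectedness enters here: the determinant is a positive number of trees. *)
have Ku : K \in unitmx.
  rewrite unitmxE -nG unitfE Num.Theory.pnatr_eq0 -lt0n.
  exact: ntrees_gt0.
pose g x y := green K (vertex_vec _ x) (vertex_vec _ y).
have gC x y : g x y = g y x by apply: green_sym; apply: kirchhoff_sym.
(* This is the effective resistance between [x] and [y], so the next claim reads t(G_xy) = t(G)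
   R(x,y). *)
pose gg x y := g x x - g x y - g y x + g y y.
have tG x y : (tid G x y)%:R = \det K * gg x y.
  rewrite (tid_det _ wf (vG p)) // det_add_rank1 // greenBl !greenBr /gg /g /=.
  ring.
pose b := edge_vec rat (p, q).
have K' : kirchhoff rat G' p = K + (- b) *m b^T.
  by rewrite /K (@kirchhoff_delete _ _ _ G p ei) ?inE //= epq mulNmx addrK.
have nG' : (ntrees G')%:R = \det K * (1 - gg p q).
  rewrite (matrix_tree _ wf' (vG' p)) K' det_add_rank1 // greenNr.
  by rewrite greenBl !greenBr /gg /g /=; ring.
(* The squared term comes from the off-diagonal entries of the rank-two update: it is the Green form
   of the edge vectors of [(p, q)] and [(s, t)]. *)
have tG' : (tid G' s t)%:R
  = \det K * ((1 - gg p q) * gg s t + (g p s - g p t - g q s + g q t) ^+ 2).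
  rewrite (tid_det _ wf' (vG' p)) // K' det_add_rank2 // det_add_rank1 //.
  rewrite !greenNr !greenBl !greenBr /= -!/(g _ _) /gg.
  rewrite ?(gC q p, gC t s, gC s p, gC s q, gC t p, gC t q).
  ring.
(* In the alternating sum of resistances the diagonal values of [g] cancel, leaving -2 times
   [g p s - g p t - g q s + g q t]; squaring gives the 4 that the factor 1/4 removes. *)
rewrite !natrM nG tG' nG' !tG /gg.
rewrite (gC q p) (gC t s) (gC s p) (gC s q) (gC t p) (gC t q).
by field.
Qed.
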